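(* Let $n,m$ be integers with $1\le m<\frac n2$ and let $\lambda$ be a partition of $n$. Then $$b_{(n-m,m)\lambda}=4\big(N^{(n-m-\lambda_1)}(\lambda)-N^{(m-\lambda_1)}(\lambda)\big).$$
   Context: For a strict partition $\xi$, $Q_\xi(x)$ is Schur's $Q$-function and $b_{\xi\lambda}$ are defined by $Q_\xi(x)=\sum_\lambda b_{\xi\lambda}s_\lambda(x)$ with $s_\lambda$ the Schur functions. For a partition $\lambda$, $\lambda^{[1]}=(\lambda_2,\lambda_3,\dots)$. A hook is a nonempty partition of the form $(a,1^b)$, $a\ge1$, $b\ge0$. For an integer $s$, $N^{(s)}(\lambda)$ is the number of partitions $\rho\subseteq\lambda^{[1]}$ such that $\rho$ is a hook and $\lambda^{[1]}/\rho$ is a vertical $s$-strip (i.e. $|\lambda^{[1]}|-|\rho|=s$ and $\lambda^{[1]}/\rho$ has at most one box in each row); in particular $N^{(s)}(\lambda)=0$ if $s<0$. *)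

(* Defs.v *)
From HB Require Import structures.
From mathcomp Require Import all_boot all_order all_fingroup all_algebra.
From mathcomp.multinomials Require Import mpoly.
From Stdlib Require Import ClassicalEpsilon.

Set Implicit Arguments.
Unset Strict Implicit.
Unset Printing Implicit Defensive.

Import Order.TTheory GRing.Theory Num.Theory.
Local Open Scope ring_scope.

(* A partition is the weakly decreasing sequence of its (positive) parts;
   lambda_(i+1) is nth 0 la i, which is 0 beyond the length. *)
Definition is_partition (la : seq nat) : bool :=
  sorted geq la && (0%N \notin la).

Definition is_partition_of (n : nat) (la : seq nat) : bool :=
  is_partition la && (sumn la == n).

(* Obtained from the n-tuples of integers in [0, n] by erasing the zeros. *)
Definition partitions (n : nat) : seq (seq nat) :=
  undup [seq la <- [seq [seq x <- [seq val i | i <- tval t] | (0 < x)%N]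
                   | t <- enum {: n.-tuple 'I_n.+1}]
        | is_partition_of n la].

Lemma partitions_uniq n : uniq (partitions n).
Proof. exact: undup_uniq. Qed.

Lemma mem_partitions n la : (la \in partitions n) = is_partition_of n la.
Proof.
rewrite mem_undup mem_filter.
case hla: (is_partition_of n la) => //=.
have [/andP[hs h0] /eqP hn] := andP hla.
have hle x : x \in la -> (x <= n)%N.
  rewrite -hn => {hla hs h0 hn}; elim: la => //= y la IH.
  rewrite inE => /predU1P[->|/IH]; first exact: leq_addr.
  by move=> h; apply: leq_trans h (leq_addl _ _).
have hsz : (size la <= n)%N.
  rewrite -hn; move: h0 => {hla hs hn hle}; elim: la => //= y la IH.
  rewrite inE negb_or eq_sym -lt0n => /andP[hy /IH h].
  by rewrite -add1n leq_add.
pose s : seq 'I_n.+1 := map inord la ++ nseq (n - size la) ord0.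
have hss : size s == n by rewrite size_cat size_map size_nseq subnKC.
have es : [seq x <- [seq val i | i <- s] | (0 < x)%N] = la.
  rewrite map_cat filter_cat map_nseq /=.
  have -> : [seq x <- nseq (n - size la) 0%N | (0 < x)%N] = [::].
    by elim: (n - size la)%N.
  rewrite cats0 -map_comp (_ : [seq _ | i <- la] = la); last first.
    rewrite -[RHS]map_id; apply/eq_in_map => x hx /=.
    by rewrite inordK // ltnS hle.
  apply/all_filterP/allP => x hx; rewrite lt0n.
  by apply: contraNneq h0 => <-.
by apply/mapP; exists (Tuple hss); rewrite ?mem_enum.
Qed.

(* a_alpha = det (x_i ^ alpha_j) in Z[x_1, ..., x_N] *)
Definition alternant (N : nat) (alpha : 'I_N -> nat) : {mpoly int[N]} :=
  \det (\matrix_(i < N, j < N) ('X_i ^+ alpha j : {mpoly int[N]})).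

(* Schur function s_la in N variables, as the ratio a_(la + delta) / a_delta
   with delta = (N-1, ..., 1, 0); it vanishes if la has more than N parts. *)
Definition schur (N : nat) (la : seq nat) : {fraction {mpoly int[N]}} :=
  if (size la <= N)%N then
    tofrac (alternant (fun j : 'I_N => nth 0%N la j + (N - j.+1))%N)
    / tofrac (alternant (fun j : 'I_N => N - j.+1)%N)
  else 0.

Definition complete_sym (N k : nat) : {mpoly int[N]} :=
  \sum_(m : 'X_{1..N < k.+1} | mdeg m == k) 'X_[m].

(* Coefficient of t^r in \prod_i (1 + x_i t) / (1 - x_i t). *)
Definition schurq (N r : nat) : {mpoly int[N]} :=
  \sum_(i < r.+1) mesym N int i * complete_sym N (r - i).

(* Q_(r,s); for s = 0 it reduces to q_r = Q_(r). *)
Definition schurQ2 (N r s : nat) : {mpoly int[N]} :=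
  schurq N r * schurq N s
  + \sum_(1 <= i < s.+1)
      ((-1) ^+ i * (schurq N (r + i) * schurq N (s - i))) *+ 2.

Definition ord_even (k : nat) (i : 'I_k) : 'I_k.*2 :=
  Ordinal (etrans (ltn_double i k) (ltn_ord i)).

Definition ord_odd (k : nat) (i : 'I_k) : 'I_k.*2 :=
  Ordinal (etrans (ltn_Sdouble i k) (ltn_ord i)).

(* Perfect matchings of 'I_k.*2 are the permutations s with
   s 0 < s 1, s 2 < s 3, ... and s 0 < s 2 < s 4 < ...; only the entries above
   the diagonal of A are used. *)
Definition pfaffian (R : comNzRingType) (k : nat) (A : 'M[R]_(k.*2)) : R :=
  \sum_(s : 'S_(k.*2) |
          [forall i : 'I_k, (s (ord_even i) < s (ord_odd i))%N] &&
          [forall i : 'I_k, forall j : 'I_k,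
             (i < j)%N ==> (s (ord_even i) < s (ord_even j))%N])
    (-1) ^+ s * \prod_(i < k) A (s (ord_even i)) (s (ord_odd i)).

(* Schur's definition of Q_xi, in N variables, for a strict partition xi: the
   Pfaffian of (Q_(xi_i, xi_j)), with xi padded by one 0 if its length is odd. *)
Definition schurQ (N : nat) (xi : seq nat) : {mpoly int[N]} :=
  pfaffian (\matrix_(i < (uphalf (size xi)).*2, j < (uphalf (size xi)).*2)
              schurQ2 N (nth 0%N xi i) (nth 0%N xi j)).

(* Q_xi = \sum_la b_la s_la as symmetric functions, i.e. in any number N of
   variables; Q_xi is homogeneous of degree |xi|. *)
Definition is_schur_expansion (xi : seq nat) (b : seq nat -> int) : Prop :=
  (forall la, ~~ is_partition_of (sumn xi) la -> b la = 0) /\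
  (forall N : nat,
     tofrac (schurQ N xi) = \sum_(la <- partitions (sumn xi)) schur N la *~ b la).

Definition bcoef (xi : seq nat) : seq nat -> int :=
  epsilon (inhabits (fun=> 0)) (is_schur_expansion xi).

Definition is_hook (rho : seq nat) : bool :=
  if rho is a :: t then (0 < a)%N && all (pred1 1%N) t else false.

Definition part_incl (rho mu : seq nat) : bool :=
  (size rho <= size mu)%N &&
  [forall i : 'I_(size mu), (nth 0 rho i <= nth 0 mu i)%N].

Definition vertical_strip (s : int) (mu rho : seq nat) : bool :=
  ((sumn mu)%:Z - (sumn rho)%:Z == s) &&
  [forall i : 'I_(size mu), (nth 0 mu i - nth 0 rho i <= 1)%N].

(* behead la is (lambda_2, lambda_3, ...); every rho contained in it is a
   partition of some k <= |behead la|. *)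
Definition Nstrip (s : int) (la : seq nat) : nat :=
  count (fun rho => [&& part_incl rho (behead la), is_hook rho
                      & vertical_strip s (behead la) rho])
        (flatten [seq partitions k | k <- iota 0 (sumn (behead la)).+1]).

(* Main.v *)
(** Since Q_(r,s) is the coefficient of t^r u^s in (t - u)/(t + u) q(t) q(u),
    where q(t) = \prod_i (1 + x_i t)/(1 - x_i t), the multiplicity of s_la in it
    is read off, up to the factor (t - u)/(t + u), from the coefficient of
    x^(la + delta) in a_delta q(t) q(u), which is the Jacobi-Trudi determinant
    det f_(la_i - i + j) of f(x) = (1+tx)(1+ux)/((1-tx)(1-ux)).  For k > 0 one has
    f_k = 2 (t+u)/(t-u) (t^k - u^k), so the first row is a combination of two
    geometric progressions.  Clearing a geometric row by column operations leaves
    the determinant of the partition (la_2, la_3, ...) for (1 - tx) f(x) =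
    (1 + tx) . (1+ux)/(1-ux), or the same with t and u exchanged.  Expanding the
    factor 1 + tx along the rows removes vertical strips, and the determinant of
    (1+ux)/(1-ux) vanishes except on hooks, by the same column operations.
    By homogeneity t is set to 1 throughout, and v stands for u. *)

Require Import Defs.
From HB Require Import structures.
From mathcomp Require Import all_boot all_order all_fingroup all_algebra.
From mathcomp.multinomials Require Import mpoly.
From mathcomp Require Import zify ring.
From Stdlib Require Import ClassicalEpsilon.
Set Implicit Arguments.
Unset Strict Implicit.
Unset Printing Implicit Defensive.

Import Order.TTheory GRing.Theory Num.Theory.
Local Open Scope ring_scope.

(** * Coefficients of the symmetric functions *)

Lemma mcoeffXM N (R : comNzRingType) k (p : {mpoly R[N]}) m :
  ('X_[k] * p)@_m = if (k <= m)%MM then p@_(m - k) else 0.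
Proof.
rewrite mulrC; case: ifP => hk; first by rewrite -[in LHS](submK hk) addmC mcoeffMX.
apply/eqP; rewrite mcoeff_eq0; apply: contraFN hk => /=.
by rewrite (perm_mem (msuppMX _ _)) => /mapP[k' _ ->]; exact: lem_addr.
Qed.

Lemma alternantE N (a : 'I_N -> nat) :
  alternant a = \sum_(w : 'S_N) (-1) ^+ w *
                  'X_[[multinom a (w i) | i < N]].
Proof.
apply: eq_bigr => w _; congr (_ * _); rewrite mpolyXE_id.
by apply: eq_bigr => i _; rewrite mxE mnmE.
Qed.

(** The coefficient of x^k in (1 + x)/(1 - x). *)
Definition qcoef (k : nat) : int := if k == 0%N then 1 else 2.

Lemma mcoeff_complete_sym N k (m : 'X_{1..N}) :
  (complete_sym N k)@_m = (mdeg m == k)%:R.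
Proof.
rewrite raddf_sum /=; case: eqP => [hm|hm] /=.
  have hb : (mdeg m < k.+1)%N by rewrite hm.
  rewrite (bigD1 (BMultinom hb)) /=; last by rewrite hm.
  rewrite mcoeffX eqxx big1 ?addr0 // => m' /andP[_ /negbTE ne].
  rewrite mcoeffX; case: eqP => // e; move: ne; rewrite -val_eqE /= e.
  by rewrite eqxx.
rewrite big1 // => m' /eqP hm'; rewrite mcoeffX; case: eqP => // e.
by rewrite -e hm' in hm.
Qed.

(** A squarefree monomial dividing x^m is a subset of the support of m, and the complete symmetric
    factor supplies the rest in one way; the number of subsets is 2 to the size of the support. *)
Lemma mcoeff_schurq N r (m : 'X_{1..N}) :
  (schurq N r)@_m = if mdeg m == r then \prod_i qcoef (m i) else 0.
Proof.
have card_le (h : {set 'I_N}) : (mesym1 h <= m)%MM -> (#|h| <= mdeg m)%N.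
  by move=> /submK <-; rewrite mdegD mdeg_mesym1 leq_addl.
transitivity (\sum_(i < r.+1) \sum_(h : {set 'I_N} | #|h| == i)
   ((mesym1 h <= m)%MM && (mdeg m == r))%:R : int).
  rewrite raddf_sum; apply: eq_bigr => i _ /=.
  rewrite mesymE mulr_suml raddf_sum; apply: eq_bigr => h /eqP hi /=.
  rewrite mcoeffXM; case: ifP => //= hk; rewrite mcoeff_complete_sym.
  have := mdegD (m - mesym1 h) (mesym1 h); rewrite (submK hk) mdeg_mesym1 hi.
  by have := ltn_ord i; rewrite ltnS => hir ->; rewrite -(eqn_add2r i) subnK.
case: eqP => hr; last by rewrite big1 // => i _; rewrite big1 // => h _; rewrite andbF.
rewrite (exchange_big_dep predT) //=.
transitivity (\sum_(h : {set 'I_N}) (mesym1 h <= m)%MM%:R : int).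
  apply: eq_bigr => h _; rewrite andbT.
  case hm: (mesym1 h <= m)%MM; last by rewrite big1.
  have hh : (#|h| < r.+1)%N by rewrite ltnS -hr card_le.
  rewrite (bigD1 (Ordinal hh)) //= big1 ?addr0 // => i /andP[/eqP e].
  by rewrite -val_eqE /= e eqxx.
rewrite [RHS](eq_bigr (fun i => (0 < m i)%N%:R + 1)); last first.
  by move=> i _; rewrite /qcoef; case: (m i).
rewrite (@bigA_distr int 0 1) [RHS]big_mkcond /=.
apply: eq_bigr => h _.
transitivity (\prod_(i < N) ((i \in h) ==> (0 < m i)%N)%:R : int); last first.
  by apply: eq_bigr => i _; case: (i \in h).
have [/mnm_lepP hm|hm] := boolP (mesym1 h <= m)%MM.
  rewrite big1 // => i _; have := hm i; rewrite mnmE; case: (i \in h) => //= ->.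
  by [].
case: (pickP (fun i => ~~ ((i \in h) ==> (0 < m i)%N))) => [i hi|hi].
  by rewrite (bigD1 i) //= (negbTE hi) mul0r.
case/negP: hm; apply/mnm_lepP => i; have := hi i; rewrite mnmE.
by case: (i \in h) => //=; case: (m i).
Qed.

Lemma leq_mdeg N (m : 'X_{1..N}) i : (m i <= mdeg m)%N.
Proof. by rewrite mdegE (bigD1 i) //= leq_addr. Qed.

Lemma schurqE N D s : (s < D)%N ->
  schurq N s = \sum_(phi : {ffun 'I_N -> 'I_D} | (\sum_i (phi i : nat))%N == s)
     (\prod_i qcoef (phi i)) *: 'X_[[multinom (phi i : nat) | i < N]].
Proof.
move=> hs; apply/mpolyP => m; rewrite mcoeff_schurq raddf_sum /=.
case: eqP => hm.
  have hb i : (m i < D)%N by rewrite (leq_ltn_trans (leq_mdeg m i)) // hm.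
  pose phi0 := [ffun i : 'I_N => Ordinal (hb i)].
  have hphi0 : [multinom (phi0 i : nat) | i < N] = m.
    by apply/mnmP => i; rewrite mnmE ffunE.
  rewrite (bigD1 phi0) /=; last first.
    by rewrite -[X in _ == X]hm mdegE; apply/eqP/eq_bigr => i _; rewrite ffunE.
  rewrite [X in _ + X]big1 => [|phi /andP[_ /eqP ne]].
    rewrite addr0 mcoeffZ mcoeffX hphi0 eqxx mulr1.
    by apply: eq_bigr => i _; rewrite ffunE.
  rewrite mcoeffZ mcoeffX; case: eqP => [e|]; last by rewrite mulr0.
  case: ne; apply/ffunP => i; apply/val_inj; rewrite ffunE /= -e.
  by rewrite mnmE.
rewrite big1 // => phi /eqP hphi; rewrite mcoeffZ mcoeffX.
case: eqP => [e|]; last by rewrite mulr0.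
case: hm; rewrite -e mdegE -hphi; apply: eq_bigr => i _; exact: mnmE.
Qed.

(* Coefficient of x^k in (1 + x)(1 + v x) / ((1 - x)(1 - v x)), with v = 'X. *)
Definition qqcoef (k : nat) : {poly int} :=
  \poly_(b < k.+1) (qcoef (k - b) * qcoef b).

Lemma coef_prod_sum (N D s : nat) (p : 'I_N -> {poly int}) :
  (forall i, size (p i) <= D)%N ->
  (\prod_i p i)`_s =
  \sum_(phi : {ffun 'I_N -> 'I_D} | (\sum_i (phi i : nat))%N == s)
     \prod_i (p i)`_(phi i).
Proof.
move=> hD.
have -> : \prod_i p i = \prod_i \sum_(j < D) (p i)`_j *: 'X^j.
  apply: eq_bigr => i _; rewrite -{1}[p i]coefK poly_def.
  rewrite (big_ord_widen _ (fun j => (p i)`_j *: 'X^j) (hD i)) big_mkcond /=.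
  apply: eq_bigr => j _; case: ltnP => // hj.
  by rewrite nth_default // scale0r.
rewrite bigA_distr_bigA coef_sum [RHS]big_mkcond /=; apply: eq_bigr => phi _.
rewrite scaler_prod -expr_sum coefZ coefXn eq_sym; case: eqP; rewrite ?mulr1 //.
by rewrite mulr0.
Qed.

(** The second factor takes an exponent vector phi <= m of total s and the first takes m - phi.
    Vectors not below m vanish on the other side too, since [qqcoef (m i)] has no term above v^(m
    i). *)
Lemma mcoeff_schurqM N r s (m : 'X_{1..N}) :
  (schurq N r * schurq N s)@_m =
  if mdeg m == (r + s)%N then (\prod_i qqcoef (m i))`_s else 0.
Proof.
rewrite mulrC (@schurqE N (r + s).+1 s) ?ltnS ?leq_addl //.
rewrite mulr_suml raddf_sum /=.
have hdeg (phi : {ffun 'I_N -> 'I_(r + s).+1}) :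
    (\sum_i (phi i : nat))%N = s -> ([multinom (phi i : nat) | i < N] <= m)%MM ->
    mdeg m = (mdeg (m - [multinom (phi i : nat) | i < N]) + s)%N.
  move=> hphi hle; rewrite -{1}(submK hle) mdegD; congr (_ + _)%N.
  by rewrite -[RHS]hphi mdegE; apply: eq_bigr => i _; rewrite mnmE.
case: eqP => hm; last first.
  rewrite big1 // => phi /eqP hphi; rewrite -scalerAl mcoeffZ mcoeffXM.
  case: ifP => [hle|_]; last by rewrite mulr0.
  rewrite mcoeff_schurq; case: eqP => [e|_]; last by rewrite mulr0.
  by case: hm; rewrite (hdeg phi) // e.
rewrite (@coef_prod_sum N (r + s).+1); last first.
  move=> i; apply: leq_trans (size_poly _ _) _.
  by rewrite ltnS -hm leq_mdeg.
apply: eq_bigr => phi /eqP hphi; rewrite -scalerAl mcoeffZ mcoeffXM.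
case: ifPn => hle.
  rewrite mcoeff_schurq ifT; last first.
    by rewrite -(eqn_add2r s) -(hdeg phi) ?hm.
  rewrite -big_split /=; apply: eq_bigr => i _.
  move/mnm_lepP/(_ i): hle; rewrite mnmE => hi.
  by rewrite coef_poly ltnS hi mnmBE mnmE mulrC.
rewrite mulr0; case: (pickP (fun i => (m i < phi i)%N)) => [i hi|hi].
  by rewrite (bigD1 i) //= coef_poly ltnS leqNgt hi mul0r.
case/negP: hle; apply/mnm_lepP => i; rewrite mnmE leqNgt; exact/negbT/hi.
Qed.

(* [v^s] of P (1 - v) / (1 + v), with v = 'X. *)
Definition skew_coef (s : nat) (P : {poly int}) : int :=
  P`_s + \sum_(1 <= i < s.+1) ((-1) ^+ i * P`_(s - i)) *+ 2.

Lemma skew_coef_is_zmod_morphism s : zmod_morphism (skew_coef s).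
Proof.
move=> P Q; rewrite /skew_coef opprD addrACA -sumrN -big_split coefB /=.
by congr (_ + _); apply: eq_bigr => i _; rewrite coefB mulrBr mulrnBl.
Qed.
HB.instance Definition _ s :=
  GRing.isZmodMorphism.Build {poly int} int (skew_coef s)
    (skew_coef_is_zmod_morphism s).

(** By telescoping, [skew_coef s.+1 P + skew_coef s P] is P_(s+1) - P_s, a coefficient of (1 - v) P,
    hence equal to Q_(s+1) + Q_s. *)
Lemma skew_coef_ratio s (P Q : {poly int}) :
  (1 - 'X) * P = (1 + 'X) * Q -> skew_coef s P = Q`_s.
Proof.
elim: s => [|s IH] h.
  rewrite /skew_coef big_nil addr0.
  have := congr1 (fun p : {poly int} => p`_0) h.
  by rewrite mulrBl mulrDl !mul1r coefB coefD !coefXM subr0 addr0.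
have := congr1 (fun p : {poly int} => p`_s.+1) h.
rewrite mulrBl mulrDl !mul1r coefB coefD !coefXM /= -(IH h) => e.
move: e; rewrite /skew_coef !big_add1 /= big_nat_recl //.
set S := (X in _ = _ + (_ + X)) => e.
have -> : \sum_(0 <= i < s) ((-1) ^+ i.+2 * P`_(s.+1 - i.+2)) *+ 2 = - S.
  rewrite -sumrN; apply: eq_bigr => i _.
  by rewrite subSS [in LHS]exprS -mulrA mulN1r mulNrn.
by rewrite subSS subn0 expr1 mulN1r addrA -[P`_s.+1](subrK P`_s) e; ring.
Qed.

Lemma mcoeff_schurQ2 N r s (m : 'X_{1..N}) :
  (schurQ2 N r s)@_m =
  if mdeg m == (r + s)%N then skew_coef s (\prod_i qqcoef (m i)) else 0.
Proof.
rewrite /schurQ2 raddfD raddf_sum /= mcoeff_schurqM.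
under eq_big_nat => i /andP[i1 i2].
  rewrite raddfMn -signr_odd raddfMsign /= signr_odd mcoeff_schurqM.
  rewrite -addnA subnKC //; over.
case: eqP => // _; rewrite big1 ?addr0 // => i _.
by rewrite mulr0 mul0rn.
Qed.

(** The identity is the only admissible matching of two points. *)
Lemma schurQ_two N r s : schurQ N [:: r; s] = schurQ2 N r s.
Proof.
rewrite /schurQ /pfaffian /=.
rewrite (big_pred1 (1%g : 'S_2)) => [|w].
  by rewrite odd_perm1 mul1r big_ord1 !perm1 mxE.
rewrite /=; apply/andP/eqP => [[/forallP /(_ ord0) h _]|->].
  have h1 := ltn_ord (w (@ord_odd 1 ord0)).
  apply/permP => i; rewrite perm1; apply/val_inj.
  case: i => [[|[|//]] hi] /=.
    rewrite (_ : Ordinal hi = @ord_even 1 ord0); last exact/val_inj.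
    by apply/eqP; rewrite -leqn0 -ltnS (leq_trans h).
  rewrite (_ : Ordinal hi = @ord_odd 1 ord0); last exact/val_inj.
  by apply/eqP; rewrite eqn_leq -ltnS h1 (leq_ltn_trans (leq0n _) h).
split; apply/forallP => i; rewrite ?perm1 /= ?ltnSn //.
by apply/forallP => j; rewrite !ord1.
Qed.

(** Since [phi] is additive, the signed sum assembles into a determinant over [{poly int}] before
    [phi] is applied. Zero entries account for the permutations whose monomial does not divide
    x^m. *)
Lemma mcoeff_alternant_mul (N n : nat) (a : 'I_N -> nat) (p : {mpoly int[N]})
    (phi : {additive {poly int} -> int}) (c : nat -> {poly int})
    (m : 'X_{1..N}) :
    (forall k, p@_k = if mdeg k == n then phi (\prod_i c (k i)) else 0) ->
  (alternant a * p)@_m =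
  if mdeg m == (n + \sum_i a i)%N then
    phi (\det (\matrix_(i, j) if (a j <= m i)%N then c (m i - a j)%N else 0))
  else 0.
Proof.
move=> hp; rewrite alternantE mulr_suml raddf_sum /=.
have mdeg_a (w : 'S_N) : mdeg [multinom a (w i) | i < N] = (\sum_i a i)%N.
  rewrite mdegE [RHS](reindex_inj (@perm_inj _ w)) /=.
  by apply: eq_bigr => i _; rewrite mnmE.
have hX (w : 'S_N) : ((-1) ^+ w * 'X_[[multinom a (w i) | i < N]] * p)@_m =
    (-1) ^+ w * ('X_[[multinom a (w i) | i < N]] * p)@_m.
  by rewrite -mulrA raddfMsign.
case: eqP => hm; last first.
  rewrite big1 // => w _; rewrite hX mcoeffXM hp.
  case: ifP => [hle|_]; last by rewrite mulr0.
  case: eqP => [e|_]; last by rewrite mulr0.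
  by case: hm; rewrite -(submK hle) mdegD mdeg_a e.
rewrite /determinant raddf_sum /=; apply: eq_bigr => w _.
rewrite hX raddfMsign /= mcoeffXM; congr (_ * _).
case: ifPn => hle.
  rewrite hp ifT; last first.
    by rewrite -(eqn_add2r (\sum_i a i)) -{1}(mdeg_a w) -mdegD submK ?hm.
  congr (phi _); apply: eq_bigr => i _; rewrite mxE mnmBE mnmE.
  by move/mnm_lepP/(_ i): hle; rewrite mnmE => ->.
case: (pickP (fun i => ~~ (a (w i) <= m i)%N)) => [i hi|hi].
  by rewrite (bigD1 i) //= mxE (negbTE hi) mul0r raddf0.
case/negP: hle; apply/mnm_lepP => i; rewrite mnmE; exact/negbFE/hi.
Qed.

(** * Jacobi-Trudi determinants *)

Section JacobiTrudi.
Variable R : comNzRingType.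
Implicit Types (c : nat -> R) (p : nat -> nat) (t w z : R).

(* The entry c_(a - i + j) of a Jacobi-Trudi matrix, where c_k = 0 for k < 0. *)
Definition jt_entry c (a i j : nat) : R :=
  if (i <= a + j)%N then c (a + j - i)%N else 0.

Definition jt N c p : R :=
  \det (\matrix_(i < N, j < N) jt_entry c (p i) i j).

(* The coefficients of (1 + z x) \sum_k c_k x^k. *)
Definition mul_lin z c (k : nat) : R :=
  c k + if k is k'.+1 then z * c k' else 0.

Lemma eq_jt N c c' p p' :
  c =1 c' -> (forall i, (i < N)%N -> p i = p' i) -> jt N c p = jt N c' p'.
Proof.
move=> hc hp; congr (\det _); apply/matrixP => i j.
by rewrite !mxE /jt_entry hp // hc.
Qed.

Lemma jt_entry_mul_lin z c a i j :
  jt_entry (mul_lin z c) a i j = jt_entry c a i j + z * jt_entry c a i.+1 j.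
Proof.
rewrite /jt_entry /mul_lin; case: (ltngtP i (a + j)%N) => [h|h|->].
- by rewrite -(subnSK h).
- by rewrite mulr0 addr0.
- by rewrite subnn mulr0.
Qed.

Lemma jt0 N c p : c 0%N = 1 -> (forall i, (i < N)%N -> p i = 0%N) -> jt N c p = 1.
Proof.
move=> c0 hp; rewrite /jt -det_tr det_trig; last first.
  apply/is_trig_mxP => i j hij.
  by rewrite !mxE /jt_entry hp // add0n leqNgt hij.
by apply: big1 => i _; rewrite !mxE /jt_entry hp // add0n leqnn subnn.
Qed.

Definition with_row0 N (r : nat -> R) c p : 'M[R]_N.+1 :=
  \matrix_(i, j) if i == ord0 then r j else jt_entry c (p i) i j.

(** Cofactors along row 0 do not see row 0, so the determinant is linear in [r] with fixed [K]; this
    allows splitting the first row into geometric ones. *)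
Lemma det_with_row0 N c p : exists K : 'I_N.+1 -> R,
  forall r, \det (with_row0 N r c p) = \sum_(j < N.+1) r j * K j.
Proof.
exists (fun j => cofactor (with_row0 N (fun=> 0) c p) ord0 j) => r.
rewrite (expand_det_row _ ord0); apply: eq_bigr => j _.
rewrite mxE eqxx /cofactor; congr (_ * (_ * \det _)).
by apply/matrixP => i k; rewrite !mxE.
Qed.

Lemma jt_with_row0 N c p :
  jt N.+1 c p = \det (with_row0 N (fun j => c (p 0%N + j)%N) c p).
Proof.
congr (\det _); apply/matrixP => i j; rewrite !mxE.
by case: eqP => // ->; rewrite /jt_entry /= subn0.
Qed.

(* Subtracting t times its left neighbour from each column. *)
Lemma det_geometric_row0 N t c p :
  \det (with_row0 N (fun j => t ^+ j) c p) = jt N (mul_lin (- t) c) (fun i => p i.+1).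
Proof.
pose T : 'M[R]_N.+1 := \matrix_(i, j) ((i == j)%:R - t * (i.+1 == j)%:R).
have detT : \det T = 1.
  rewrite -det_tr det_trig; last first.
    apply/is_trig_mxP => i j hij; rewrite !mxE.
    by rewrite -val_eqE /= !gtn_eqF ?mulr0 ?subr0 // ltnW.
  by apply: big1 => i _; rewrite !mxE eqxx gtn_eqF // mulr0 subr0.
set M := with_row0 _ _ _ _.
have MT0 i : (M *m T) i ord0 = M i ord0.
  rewrite mxE (bigD1 ord0) //= [T _ _]mxE eqxx mulr0 subr0 mulr1 big1 ?addr0 //.
  by move=> k hk; rewrite [T _ _]mxE (negbTE hk) mulr0 subr0 mulr0.
have MTS i (j : 'I_N) : (M *m T) i (lift ord0 j) =
    M i (lift ord0 j) - t * M i (widen_ord (leqnSn N) j).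
  rewrite mxE; under eq_bigr do rewrite [T _ _]mxE mulrBr.
  rewrite sumrB; congr (_ - _).
    rewrite (bigD1 (lift ord0 j)) //= eqxx mulr1 big1 ?addr0 //.
    by move=> k hk; rewrite (negbTE hk) mulr0.
  rewrite (bigD1 (widen_ord (leqnSn N) j)) //= eqxx mulr1 mulrC big1 ?addr0 //.
  move=> k; rewrite -val_eqE /= => hk.
  by rewrite /bump /= eqSS (negbTE hk) !mulr0.
(* The new first row is (1, 0, ..., 0), so a single minor survives. *)
rewrite -[LHS]mulr1 -detT -det_mulmx (expand_det_row _ ord0) big_ord_recl.
rewrite MT0 mxE eqxx expr0 mul1r big1 ?addr0 => [|j _]; last first.
  by rewrite MTS !mxE !eqxx exprS subrr mul0r.
rewrite /cofactor addn0 expr0 mul1r; congr (\det _); apply/matrixP => i j.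
rewrite mxE [LHS]mxE MTS !mxE /= jt_entry_mul_lin mulNr.
by rewrite /jt_entry /bump /= !add1n !addnS !ltnS !subSS.
Qed.

(** Multilinearity in the rows: S records the rows taken from [z *: B]. *)
Lemma det_add_scale N z (A B : 'M[R]_N) :
  \det (A + z *: B) = \sum_(S : {set 'I_N}) z ^+ #|S| *
     \det (\matrix_(i, j) if i \in S then B i j else A i j).
Proof.
rewrite /determinant.
transitivity (\sum_(w : 'S_N) \sum_(S : {set 'I_N})
    (-1) ^+ w * \prod_i (if i \in S then z * B i (w i) else A i (w i))).
  apply: eq_bigr => w _; rewrite -mulr_sumr; congr (_ * _).
  under eq_bigr do rewrite !mxE addrC.
  by rewrite (@bigA_distr R 0 1) big_mkcond.
rewrite exchange_big; apply: eq_bigr => S _ /=.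
rewrite mulr_sumr; apply: eq_bigr => w _; rewrite mulrCA; congr (_ * _).
rewrite -prodr_const [X in _ = X * _]big_mkcond -big_split /=.
by apply: eq_bigr => i _; rewrite mxE; case: ifP; rewrite ?mul1r.
Qed.

(** Membership is false beyond N, so that the row below the last one can be queried. *)
Definition inset N (S : {set 'I_N}) (i : nat) : bool :=
  i \in [seq val j | j in S].

Lemma insetE N (S : {set 'I_N}) (i : 'I_N) : inset S i = (i \in S).
Proof. exact: mem_image val_inj _ _. Qed.

Lemma inset_ge N (S : {set 'I_N}) i : (N <= i)%N -> inset S i = false.
Proof.
move=> hi; apply/negP => /mapP[j _ e].
by have := ltn_ord j; rewrite -[nat_of_ord j]e ltnNge hi.
Qed.

Definition strip_part p N (S : {set 'I_N}) (i : nat) : nat := (p i - inset S i)%N.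

(* Equivalently, removing one box from each row in S leaves a partition: among
   equal parts, the lower ones must be shortened first. *)
Definition removable p N (S : {set 'I_N}) : bool :=
  [forall i in S, (p i == p i.+1) ==> inset S i.+1].

Section Removable.
Variables (p : nat -> nat) (N : nat) (S : {set 'I_N}).
Hypothesis pdec : forall i, (p i.+1 <= p i)%N.

(** From i downwards the rows stay in S as long as p is constant, and S ends before N; so p drops
    strictly at some point. *)
Lemma removable_gt0 i : removable p S -> inset S i -> (0 < p i)%N.
Proof.
move=> /forall_inP hS; move e: (N - i)%N => k.
elim: k i e => [|k IH] i e hi.
  by rewrite inset_ge // -subn_eq0 e in hi.
have iN : (i < N)%N by rewrite -subn_gt0 e.
have := hS (Ordinal iN); rewrite -insetE /= => /(_ hi)/implyP h.
have := pdec i; rewrite leq_eqVlt => /predU1P[e'|]; last exact: leq_trans.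
by rewrite -e' IH ?h ?e' // subnS e.
Qed.

Lemma strip_part_dec i : removable p S -> (strip_part p S i.+1 <= strip_part p S i)%N.
Proof.
move=> hS; rewrite /strip_part; have := pdec i.
case hi: (inset S i) => /=; last by case: inset => /=; lia.
have iN : (i < N)%N by rewrite ltnNge; apply: contraTN hi => /(inset_ge S) ->.
have /forall_inP/(_ (Ordinal iN)) := hS; rewrite -insetE /= => /(_ hi)/implyP.
case: eqP => [e /(_ isT) -> /=|]; first by lia.
by case: inset => /=; lia.
Qed.

(** Moving the row index from i to i+1 amounts to shortening p_i by one; p_i > 0 makes the truncated
    subtraction exact. *)
Lemma jt_strip_part c : removable p S ->
  \det (\matrix_(i < N, j < N)
     if i \in S then jt_entry c (p i) i.+1 j else jt_entry c (p i) i j) =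
  jt N c (strip_part p S).
Proof.
move=> hS; congr (\det _); apply/matrixP => i j; rewrite !mxE /strip_part insetE.
have := @removable_gt0 i hS; rewrite insetE; case: ifP => _ /=; last by rewrite subn0.
case: (p i) => [/(_ isT)//|a _].
by rewrite /jt_entry addSn subSS subn1 ltnS.
Qed.

(** Removability fails at some i in S with p_i = p_(i+1) and i+1 outside S, so rows i and i+1
    coincide; if i is the last row, p_i = p_N = 0 makes that row zero. *)
Lemma jt_not_removable c : p N = 0%N -> ~~ removable p S ->
  \det (\matrix_(i < N, j < N)
     if i \in S then jt_entry c (p i) i.+1 j else jt_entry c (p i) i j) = 0.
Proof.
move=> pN /forall_inPn /= [i iS]; rewrite negb_imply => /andP[/eqP e hS].
have := ltn_ord i; rewrite leq_eqVlt => /predU1P[eN|hi].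
  rewrite (expand_det_row _ i) big1 // => j _.
  by rewrite mxE iS /jt_entry e eN pN leqNgt ltn_ord mul0r.
apply: (@determinant_alternate _ _ _ i (Ordinal hi)).
  by rewrite -val_eqE /= neq_ltn ltnSn.
by move=> j; rewrite !mxE iS -(insetE S (Ordinal hi)) /= (negbTE hS) e.
Qed.

End Removable.

Lemma jt_mul_lin N z c p : (forall i, (p i.+1 <= p i)%N) -> p N = 0%N ->
  jt N (mul_lin z c) p =
  \sum_(S : {set 'I_N} | removable p S) z ^+ #|S| * jt N c (strip_part p S).
Proof.
move=> pdec pN; pose A k : 'M[R]_N := \matrix_(i, j) jt_entry c (p i) (i + k) j.
have -> : jt N (mul_lin z c) p = \det (A 0%N + z *: A 1%N).
  congr (\det _); apply/matrixP => i j.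
  by rewrite !mxE jt_entry_mul_lin addn0 addn1.
rewrite det_add_scale [RHS]big_mkcond; apply: eq_bigr => S _ /=.
under eq_mx do rewrite !mxE addn0 addn1.
case: ifPn => hS; first by rewrite jt_strip_part.
by rewrite jt_not_removable // mulr0.
Qed.

(* The coefficients of (1 + w x) / (1 - w x). *)
Definition geom_q w (k : nat) : R := if k == 0%N then 1 else 2 * w ^+ k.

Definition lin_coef w (k : nat) : R :=
  if k == 0%N then 1 else if k == 1%N then w else 0.

Lemma mul_lin_geom_q w : mul_lin (- w) (geom_q w) =1 lin_coef w.
Proof.
case=> [|[|k]]; rewrite /mul_lin /geom_q /lin_coef /= ?addr0 //.
  by rewrite expr1; ring.
by rewrite [w ^+ k.+2]exprS; ring.
Qed.

(** If p_0 = 1, the first row is (w, 0, ..., 0), which is w times the geometric row of ratio 0, and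
    clearing it leaves the same problem for the remaining parts. If p_0 >= 2, the first row is
    zero. *)
Lemma jt_lin_coef N w p : (forall i, (p i.+1 <= p i)%N) ->
  jt N (lin_coef w) p =
  if (p 0%N <= 1)%N || (N == 0%N) then w ^+ (\sum_(i < N) p i) else 0.
Proof.
elim: N p => [|N IH] p pdec.
  by rewrite orbT big_ord0 expr0 /jt det_mx00.
rewrite orbF.
have [K hK] := det_with_row0 N (lin_coef w) p.
case hp: (p 0%N) => [|[|a]] /=.
- have p0 i : p i = 0%N.
    by elim: i => // i IHi; have := pdec i; rewrite IHi leqn0 => /eqP.
  by rewrite jt0 // big1.
- rewrite jt_with_row0 hK hp; transitivity (w * \sum_(j < N.+1) 0 ^+ j * K j).
    rewrite mulr_sumr; apply: eq_bigr => j _; rewrite mulrA.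
    case: (nat_of_ord j) => [|k]; rewrite /lin_coef ?addn0 ?expr0 ?mulr1 //.
    by rewrite expr0n /= mulr0.
  rewrite -(hK (fun j => 0 ^+ j)) det_geometric_row0.
  rewrite (@eq_jt _ _ (lin_coef w) _ (fun i => p i.+1)) //; last first.
    by move=> [|k]; rewrite /mul_lin ?addr0 // oppr0 mul0r addr0.
  rewrite IH; last by move=> i; exact: pdec.
  have -> : (p 1 <= 1)%N by rewrite -[X in (_ <= X)%N]hp pdec.
  rewrite big_ord_recl hp -exprS; congr (_ ^+ _).
- by rewrite jt_with_row0 hK hp big1 // => j _; rewrite mul0r.
Qed.

(** If p_0 > 0, the first row is 2 w^(p_0) times the geometric row of ratio w. Clearing it turns (1
    + w x)/(1 - w x) into 1 + w x, whose determinant allows only parts equal to 1 below. *)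
Lemma jt_geom_q N w p : (forall i, (p i.+1 <= p i)%N) -> p N = 0%N ->
  jt N (geom_q w) p =
  if p 0%N == 0%N then 1 else
  if (p 1 <= 1)%N then 2 * w ^+ (\sum_(i < N) p i) else 0.
Proof.
move=> pdec pN; case: eqP => p0.
  apply: jt0 => // i _.
  by elim: i => // i IHi; have := pdec i; rewrite IHi leqn0 => /eqP.
case: N pN => [|N] pN; first by case: p0.
have [K hK] := det_with_row0 N (geom_q w) p.
rewrite jt_with_row0 hK.
transitivity (2 * w ^+ p 0%N * \sum_(j < N.+1) w ^+ j * K j).
  rewrite mulr_sumr; apply: eq_bigr => j _; rewrite mulrA; congr (_ * _).
  by rewrite /geom_q addn_eq0 (introF eqP p0) exprD mulrA.
rewrite -(hK (fun j => w ^+ j)) det_geometric_row0.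
rewrite (eq_jt (mul_lin_geom_q w) (fun _ _ => erefl)) jt_lin_coef; last first.
  by move=> i; exact: pdec.
have -> : (p 1 <= 1)%N || (N == 0%N) = (p 1 <= 1)%N.
  by case: N pN {K hK} => [->|N]; rewrite ?orbF.
by case: ifP => _; rewrite ?mulr0 // -mulrA -exprD big_ord_recl.
Qed.

End JacobiTrudi.

(** * The Jacobi-Trudi determinant of [qqcoef] *)

Lemma qqcoef0 : qqcoef 0 = 1.
Proof.
by apply/polyP => i; rewrite coef_poly coef1; case: i.
Qed.

Lemma qqcoefS k : (1 - 'X) * qqcoef k.+1 = 2 * (1 + 'X) * (1 - 'X^(k.+1)).
Proof.
(* The coefficients are 2, 4, ..., 4, 2, as one of the two factors is 1 at each end. *)
have -> : qqcoef k.+1 = 4 * (\sum_(i < k.+2) 'X^i) - 2 - 2 * 'X^(k.+1).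
  apply/polyP => i; rewrite -!polyC_natr !coefB !coefCM coefC coefXn.
  under eq_bigr do rewrite -[_ ^+ _]scale1r.
  rewrite -(poly_def _ (fun=> 1)) !coef_poly.
  case: ltnP => hi; last first.
    by rewrite (gtn_eqF hi) gtn_eqF // (leq_trans _ hi).
  rewrite /qcoef subn_eq0; case: (ltngtP i k.+1) hi => [h _|h|-> _].
    by case: (i == 0%N).
    by rewrite ltnS leqNgt h.
  by [].
rewrite !mulrBr mulrCA.
have -> : (1 - 'X) * (\sum_(i < k.+2) 'X^i) = 1 - 'X^(k.+2) :> {poly int}.
  by apply: oppr_inj; rewrite -mulNr !opprB subrX1.
by rewrite [_ ^+ k.+2]exprS; ring.
Qed.

Lemma oneBX_neq0 : 1 - 'X != 0 :> {poly int}.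
Proof. by rewrite -opprB oppr_eq0 polyXsubC_eq0. Qed.

Lemma mul_lin_qqcoef1 : mul_lin (- 1) qqcoef =1 mul_lin 1 (geom_q 'X).
Proof.
move=> k; apply: (mulfI oneBX_neq0).
case: k => [|[|k]]; rewrite /mul_lin /geom_q /= ?qqcoef0 // mulrDr ?qqcoefS.
  by rewrite !expr1; ring.
by rewrite mulrCA qqcoefS [_ ^+ k.+2]exprS; ring.
Qed.

Lemma mul_lin_qqcoefX : mul_lin (- 'X) qqcoef =1 mul_lin 'X (geom_q 1).
Proof.
move=> k; apply: (mulfI oneBX_neq0).
case: k => [|[|k]]; rewrite /mul_lin /geom_q /= ?qqcoef0 // mulrDr ?qqcoefS.
  by rewrite !expr1; ring.
by rewrite mulrCA qqcoefS [_ ^+ k.+2]exprS !expr1n; ring.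
Qed.

(** Times 1 - v, entry j of the first row is 2 (1 + v) (1 - v^(p_0) v^j), a combination of the
    geometric rows of ratios 1 and v; p_0 > 0 keeps the exceptional value [qqcoef 0] out of this
    row. The shape is that required by [skew_coef_ratio]. *)
Lemma jt_qqcoef N p : (0 < p 0)%N ->
  (1 - 'X) * jt N.+1 qqcoef p =
  (1 + 'X) * (2 * (jt N (mul_lin 1 (geom_q 'X)) (fun i => p i.+1)
            - 'X^(p 0%N) * jt N (mul_lin 'X (geom_q 1)) (fun i => p i.+1))).
Proof.
move=> p0; have [K hK] := det_with_row0 N qqcoef p.
rewrite -(eq_jt mul_lin_qqcoef1 (fun _ _ => erefl)).
rewrite -(eq_jt mul_lin_qqcoefX (fun _ _ => erefl)).
rewrite -!det_geometric_row0 jt_with_row0 !hK.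
rewrite ['X^_ * _]mulr_sumr -sumrB !mulr_sumr; apply: eq_bigr => j _.
rewrite -{1}(prednK p0) addSn mulrA qqcoefS expr1n -addSn prednK // exprD.
ring.
Qed.

(** * Coefficients as counts of vertical strips *)

Definition hook_part (p : nat -> nat) : bool := (0 < p 0)%N && (p 1 <= 1)%N.

Section Strips.
Variables (N : nat) (p : nat -> nat).
Hypotheses (pdec : forall i, (p i.+1 <= p i)%N) (pN : p N = 0%N).

Lemma sum_strip_part (S : {set 'I_N}) : removable p S ->
  (\sum_(i < N) strip_part p S i + #|S|)%N = (\sum_(i < N) p i)%N.
Proof.
move=> hS; rewrite -sum1_card [X in (_ + X)%N]big_mkcond -big_split; apply: eq_bigr => i _ /=.
rewrite /strip_part; have := removable_gt0 pdec (i := i) hS.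
rewrite insetE; case: (i \in S) => [/(_ isT) h|_] /=; last by rewrite subn0 addn0.
by rewrite subnK.
Qed.

Lemma jt_strip_geom_q (R : comNzRingType) (w : R) (S : {set 'I_N}) :
  removable p S ->
  jt N (geom_q w) (strip_part p S) =
  (strip_part p S 0 == 0%N)%:R +
  (hook_part (strip_part p S))%:R * (2 * w ^+ (\sum_(i < N) strip_part p S i)).
Proof.
move=> hS; rewrite jt_geom_q; first last.
- by rewrite /strip_part pN.
- by move=> i; exact: strip_part_dec.
rewrite /hook_part; case: (strip_part p S 0) => [|k] /=; first by rewrite mul0r addr0.
by rewrite add0r; case: ifP => _; rewrite ?mul1r ?mul0r.
Qed.

Lemma strip_part0_card (S : {set 'I_N}) : removable p S ->
  strip_part p S 0 = 0%N -> #|S| = (\sum_(i < N) p i)%N.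
Proof.
move=> hS h0; rewrite -(sum_strip_part hS) big1 // => i _.
by elim: (nat_of_ord i) => // j IH; have := strip_part_dec pdec j hS; rewrite IH leqn0 => /eqP.
Qed.

(** The empty partition contributes only to v^0, excluded by m > 0; a hook contributes 2 v^(|p| -
    |S|). *)
Lemma coef_strips_X m : (0 < m)%N ->
  (jt N (mul_lin 1 (geom_q 'X)) p)`_m =
  \sum_(S : {set 'I_N} | [&& removable p S, hook_part (strip_part p S)
             & #|S| + m == \sum_(i < N) p i]%N) 2 :> int.
Proof.
move=> m0; rewrite jt_mul_lin // coef_sum big_mkcondr /=.
apply: eq_bigr => S hS; rewrite expr1n mul1r jt_strip_geom_q //.
rewrite coefD -polyC_natr coefC gtn_eqF // add0r mulrCA -!polyC_natr !coefCM coefXn.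
rewrite -(sum_strip_part hS) [(_ + #|S|)%N]addnC eqn_add2l.
by case: hook_part; case: eqP.
Qed.

(** Here the exponent of v is a + |S|. The empty partition has |S| = |p|, so it would occur only at
    v^(a + |p|), which the bound on m excludes. *)
Lemma coef_strips_1 a m : (m < a + \sum_(i < N) p i)%N ->
  ('X^a * jt N (mul_lin 'X (geom_q 1)) p)`_m =
  \sum_(S : {set 'I_N} | [&& removable p S, hook_part (strip_part p S)
             & a + #|S| == m]%N) 2 :> int.
Proof.
move=> ma; rewrite jt_mul_lin // mulr_sumr coef_sum big_mkcondr /=.
apply: eq_bigr => S hS; rewrite jt_strip_geom_q // expr1n mulr1 mulrA -exprD.
rewrite -!polyC_natr -polyCM -polyCD coefMC coefXn [_ == m]eq_sym.
case: (m =P _) => [em|_]; last by rewrite andbF mul0r.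
rewrite andbT mul1r; case: eqP => [e|_].
  by move: ma; rewrite em (strip_part0_card hS e) ltnn.
by case: hook_part.
Qed.
End Strips.

(** * Vertical strips as sets of rows *)

Lemma partition_dec la i : is_partition la -> (nth 0 la i.+1 <= nth 0 la i)%N.
Proof.
move=> /andP[/(sortedP 0%N) h _]; case: (ltnP i.+1 (size la)) => [|hi]; first exact: h.
by rewrite nth_default.
Qed.

Lemma partition_nth_gt0 la i : is_partition la -> (0 < nth 0 la i)%N = (i < size la)%N.
Proof.
move=> /andP[_ h]; case: (ltnP i) => hi; last by rewrite nth_default.
by rewrite lt0n; apply: contraNneq h => <-; exact: mem_nth.
Qed.

Lemma eq_partition la mu : is_partition la -> is_partition mu ->
  nth 0%N la =1 nth 0%N mu -> la = mu.
Proof.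
move=> hla hmu e; apply: (@eq_from_nth _ 0%N) => [|i _]; last exact: e.
case: (ltngtP (size la) (size mu)) => // h.
  by have := partition_nth_gt0 (size la) hmu; rewrite h -e nth_default.
by have := partition_nth_gt0 (size mu) hla; rewrite h e nth_default.
Qed.

Lemma is_partition_behead la : is_partition la -> is_partition (behead la).
Proof.
case: la => // a la /andP[/= /path_sorted h]; rewrite inE negb_or => /andP[_ h0].
exact/andP.
Qed.

Lemma sum_nth_sumn la N : (size la <= N)%N -> (\sum_(i < N) nth 0 la i)%N = sumn la.
Proof.
move=> h; rewrite sumnE (big_nth 0%N) big_mkord (big_ord_widen _ _ h) [RHS]big_mkcond /=.
by apply: eq_bigr => i _; case: ltnP => // hi; rewrite nth_default.
Qed.

Definition to_partition N (q : nat -> nat) : seq nat :=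
  [seq x <- mkseq q N | (0 < x)%N].

(** Erasing zeros moves nothing, since in a decreasing sequence they come last. *)
Lemma nth_to_partition N q i : (forall i, (q i.+1 <= q i)%N) -> q N = 0%N ->
  nth 0%N (to_partition N q) i = q i.
Proof.
elim: N q i => [|N IH] q i qdec qN.
  rewrite nth_nil; elim: i => // i e; have := qdec i; rewrite -e leqn0.
  by move/eqP.
have e : to_partition N.+1 q = [seq x <- q 0%N :: mkseq (fun i => q i.+1) N | (0 < x)%N].
  by rewrite /to_partition /mkseq -[N.+1]add1n iotaD /= (iotaDl 1) -map_comp.
rewrite e /=; case: posnP => h0.
  have q0 k : q k = 0%N by elim: k => // k ek; have := qdec k; rewrite ek leqn0 => /eqP.
  rewrite q0 (eq_in_filter (a2 := pred0)) ?filter_pred0 ?nth_nil //.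
  by move=> x /mapP[k _ ->]; rewrite q0.
by case: i => //= i; apply: IH => // k; exact: qdec.
Qed.

Lemma is_partition_to_partition N q : (forall i, (q i.+1 <= q i)%N) -> q N = 0%N ->
  is_partition (to_partition N q).
Proof.
move=> qdec qN; apply/andP; split; last by rewrite mem_filter.
by apply/(sortedP 0%N) => i _; rewrite !nth_to_partition // /geq /=.
Qed.

Lemma size_to_partition N q : (size (to_partition N q) <= N)%N.
Proof. by rewrite size_filter (leq_trans (count_size _ _)) ?size_mkseq. Qed.

Lemma to_partitionK N la : is_partition la -> (size la <= N)%N ->
  to_partition N (nth 0%N la) = la.
Proof.
move=> hla hN; have dec i := partition_dec i hla.
have h0 : nth 0%N la N = 0%N by rewrite nth_default.
apply: eq_partition => //; first exact: is_partition_to_partition.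
by move=> i; exact: nth_to_partition.
Qed.

Lemma partition_le la i j : is_partition la -> (i <= j)%N ->
  (nth 0 la j <= nth 0 la i)%N.
Proof.
move=> hla; elim: j => [|j IH]; first by rewrite leqn0 => /eqP->.
rewrite leq_eqVlt => /predU1P[->//|/IH]; exact/leq_trans/partition_dec.
Qed.

Lemma is_hookE la : is_partition la -> is_hook la = hook_part (nth 0%N la).
Proof.
rewrite /hook_part; case: la => // a t hla /=; congr (_ && _).
have ht := is_partition_behead hla.
apply/(all_nthP 0%N)/idP => [h|h i hi].
  by case: t h {hla ht} => // b t /(_ 0%N isT)/eqP /= ->.
rewrite /= eqn_leq (leq_trans (partition_le ht (leq0n i)) h) /=.
by rewrite [(0 < _)%N]partition_nth_gt0.
Qed.

Definition subpartitions (n : nat) : seq (seq nat) :=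
  flatten [seq partitions k | k <- iota 0 n.+1].

Lemma mem_subpartitions n la :
  (la \in subpartitions n) = is_partition la && (sumn la <= n)%N.
Proof.
apply/flatten_mapP/andP => [[k]|[hla hn]].
  by rewrite mem_iota mem_partitions ltnS => hk /andP[-> /eqP->].
by exists (sumn la); rewrite ?mem_iota ?ltnS // mem_partitions /is_partition_of hla eqxx.
Qed.

Lemma subpartitions_uniq n : uniq (subpartitions n).
Proof.
rewrite /subpartitions; move: (iota_uniq 0 n.+1).
elim: (iota 0 n.+1) => //= k s IH /andP[ks /IH us]; rewrite cat_uniq partitions_uniq us andbT.
apply/hasPn => la /flatten_mapP[l ls]; rewrite !mem_partitions => /andP[_ /eqP e].
by apply/negP => /andP[_ /eqP e']; move: ks; rewrite -e' e ls.
Qed.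

Section Count.
Variables (N : nat) (mu : seq nat).
Hypotheses (hmu : is_partition mu) (hN : (size mu <= N)%N).
Let p := nth 0%N mu.
Let pdec i : (p i.+1 <= p i)%N. Proof. exact: partition_dec. Qed.
Let pN : p N = 0%N. Proof. by rewrite /p nth_default. Qed.

Let strip_partN (S : {set 'I_N}) : strip_part p S N = 0%N.
Proof. by rewrite /strip_part pN. Qed.

Let nth_strip (S : {set 'I_N}) i : removable p S ->
  nth 0%N (to_partition N (strip_part p S)) i = strip_part p S i.
Proof. by move=> hS; apply: nth_to_partition => // k; exact: strip_part_dec. Qed.

Lemma to_partition_strip_inj :
  {in [pred S : {set 'I_N} | removable p S] &,
    injective (fun S : {set 'I_N} => to_partition N (strip_part p S))}.
Proof.
move=> S T /= hS hT e; apply/setP => i.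
have : strip_part p S i = strip_part p T i by rewrite -!nth_strip // e.
rewrite /strip_part; have := removable_gt0 pdec (i := i) hS.
have := removable_gt0 pdec (i := i) hT; rewrite !insetE.
by case: (i \in S); case: (i \in T) => //= h1 h2; lia.
Qed.

(** The inverse of removing boxes: the rows that have lost one. *)
Let strip_rows rho : {set 'I_N} := [set i : 'I_N | (nth 0 rho i < p i)%N].

Let strip_rowsP rho : is_partition rho -> part_incl rho mu ->
  [forall i : 'I_(size mu), (nth 0 mu i - nth 0 rho i <= 1)%N] ->
  strip_part p (strip_rows rho) =1 nth 0%N rho.
Proof.
move=> hrho /andP[hs /forallP hi] /forallP h1 i; rewrite /strip_part.
case: (ltnP i (size mu)) => hsi; last first.
  by rewrite /p !nth_default // (leq_trans hs).
have := hi (Ordinal hsi); have := h1 (Ordinal hsi); rewrite /= -/p.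
rewrite (_ : inset _ _ = (nth 0 rho i < p i)%N); first by case: ltnP => /=; lia.
by rewrite -[i]/(val (Ordinal (leq_trans hsi hN))) insetE inE.
Qed.

Let strip_rows_removable rho : is_partition rho -> removable p (strip_rows rho).
Proof.
move=> hrho; apply/forall_inP => i; rewrite inE => hi; apply/implyP => /eqP e.
have hi1 : (i.+1 < N)%N.
  apply: leq_trans hN; rewrite -partition_nth_gt0 // -/p -e.
  exact: leq_ltn_trans hi.
rewrite -[i.+1]/(val (Ordinal hi1)) insetE inE /= -e.
exact: leq_ltn_trans (partition_dec i hrho) hi.
Qed.

(** Removing one box from each row of S is a bijection from the removable sets to the rho with
    mu/rho a vertical strip, with inverse [strip_rows]; |S| is the size of the strip. *)
Lemma NstripE (s : int) la : behead la = mu ->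
  Nstrip s la = #|[set S : {set 'I_N} | [&& removable p S,
                     hook_part (strip_part p S) & (#|S|)%:Z == s]]|.
Proof.
move=> hla; rewrite /Nstrip hla -/(subpartitions (sumn mu)).
set A := [set S | _].
rewrite -size_filter cardE -(size_map (fun S => to_partition N (strip_part p S))).
have sum_p : (\sum_(i < N) p i)%N = sumn mu := sum_nth_sumn hN.
apply/perm_size/uniq_perm.
- exact/filter_uniq/subpartitions_uniq.
- rewrite map_inj_in_uniq ?enum_uniq // => S T.
  rewrite !mem_enum !inE => /and3P[hS _ _] /and3P[hT _ _].
  exact: to_partition_strip_inj.
move=> rho; rewrite mem_filter mem_subpartitions; apply/idP/mapP.
  move=> /andP[/and3P[hincl hhook /andP[/eqP hs h1]] /andP[hrho _]].
  have e := strip_rowsP hrho hincl h1.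
  have hrem := strip_rows_removable hrho.
  exists (strip_rows rho).
    rewrite mem_enum inE hrem /hook_part !e -/(hook_part (nth 0%N rho)).
    rewrite -is_hookE // hhook /= -hs.
    have := sum_strip_part pdec hrem; rewrite sum_p.
    under eq_bigr do rewrite e.
    case/andP: hincl => hsz _.
    rewrite sum_nth_sumn ?(leq_trans hsz) // => <-.
    by rewrite PoszD addrC addKr.
  rewrite -{1}(to_partitionK hrho (leq_trans (proj1 (andP hincl)) hN)).
  by congr filter; apply: eq_map => i; rewrite e.
move=> [S]; rewrite mem_enum inE => /and3P[hS hhook /eqP hs] ->.
set r := to_partition _ _.
have hr : is_partition r.
  by apply: is_partition_to_partition => // i; exact: strip_part_dec.
have er i : nth 0%N r i = strip_part p S i by exact: nth_strip.
have hsum : (sumn r + #|S|)%N = sumn mu.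
  rewrite -sum_p -(sum_strip_part pdec hS); congr (_ + _)%N.
  rewrite -(sum_nth_sumn (size_to_partition N _)).
  by apply: eq_bigr => i _; exact: er.
rewrite hr is_hookE // /hook_part !er -/(hook_part _) hhook /=.
rewrite -hsum leq_addr andbT; apply/and3P; split.
- apply/andP; split; last by apply/forallP => i; rewrite er leq_subr.
  rewrite leqNgt -partition_nth_gt0 // er /strip_part /p nth_default //.
- by rewrite -hs -hsum PoszD addrAC subrr add0r.
- by apply/forallP => i; rewrite er /strip_part -/p; case: inset => /=; lia.
Qed.

End Count.

(** * Alternating polynomials and Schur expansions *)

Definition strictly_dec N (a : 'I_N -> nat) : Prop :=
  forall i j : 'I_N, (i < j)%N -> (a j < a i)%N.

Definition alternating N (P : {mpoly int[N]}) : Prop :=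
  forall s : 'S_N, msym s P = (-1) ^+ s * P.

(** Permuting the variables permutes the rows of the matrix. *)
Lemma alternating_alternant N (a : 'I_N -> nat) : alternating (alternant a).
Proof.
move=> s; rewrite /alternant -det_map_mx -det_perm -det_mulmx -row_permE.
congr (\det _); apply/matrixP => i j.
rewrite !mxE rmorphXn /= msymX; congr ('X_[_] ^+ _).
by apply/mnmP => k; rewrite !mnmE -(inj_eq (@perm_inj _ s)) permKV.
Qed.

(** Sorting the exponents changes a coefficient only by a sign, and a repeated exponent makes it
    equal to its own negative. *)
Lemma alternating_eq0 N (P : {mpoly int[N]}) : alternating P ->
  (forall m : 'X_{1..N}, strictly_dec (fun i => m i) -> P@_m = 0) -> P = 0.
Proof.
move=> hP h0; apply/mpolyP => m; rewrite mcoeff0.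
have hs (s : 'S_N) : P@_[multinom m (s i) | i < N] = (-1) ^+ s * P@_m.
  by rewrite -mcoeff_sym hP -[in RHS]signr_odd -[in LHS]signr_odd raddfMsign.
have [/injectiveP inj|] := boolP (injectiveb (fun i : 'I_N => m i)); last first.
  case/injectivePn => i [j ij e].
  have e' : [multinom m (tperm i j k) | k < N] = m.
    by apply/mnmP => k; rewrite mnmE; case: tpermP => [->|->|].
  have := hs (tperm i j); rewrite e' odd_tperm ij expr1; lia.
have geq_tr : transitive geq by move=> x y z h1 h2; exact: leq_trans h2 h1.
have geq_tot : total geq by move=> x y; rewrite /geq /= leq_total.
have /tuple_permP[s es] : perm_eq (sort geq m) m by rewrite perm_sort.
have hm : P@_[multinom m (s i) | i < N] = 0.
  apply: h0 => i j ij; rewrite ltn_neqAle; apply/andP; split.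
    rewrite !mnmE; apply: contraTneq ij => /inj/perm_inj ->; by rewrite ltnn.
  have /(sorted_leq_nth geq_tr leqnn 0%N) := sort_sorted geq_tot m.
  rewrite es => /(_ i j); rewrite !inE size_map -cardE card_ord !ltn_ord.
  by move=> /(_ isT isT (ltnW ij)); rewrite -!tnth_nth !tnth_mktuple !mnmE. 
by have := hs s; rewrite hm => /esym/eqP; rewrite mulf_eq0 signr_eq0 => /eqP.
Qed.

(** The exponents la + delta of the numerator in [schur]; [staircase] is delta. *)
Definition shifted N (la : seq nat) (j : 'I_N) : nat := (nth 0 la j + (N - j.+1))%N.
Definition staircase N (j : 'I_N) : nat := (N - j.+1)%N.

Lemma strictly_dec_shifted N la : is_partition la -> strictly_dec (@shifted N la).
Proof.
move=> hla i j ij; rewrite /shifted -addnS leq_add ?partition_le ?(ltnW ij) //.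
by have := ltn_ord j; lia.
Qed.

(** An increasing permutation satisfies i <= w i, and so does its inverse. *)
Lemma incr_perm1 N (w : 'S_N) :
  (forall i j : 'I_N, (i < j)%N -> (w i < w j)%N) -> w = 1%g.
Proof.
have ge (v : 'S_N) : (forall i j : 'I_N, (i < j)%N -> (v i < v j)%N) ->
    forall i : 'I_N, (i <= v i)%N.
  move=> hv [k hk] /=; elim: k hk => [|k IH] hk //.
  by apply: leq_ltn_trans (IH (ltnW hk)) (hv _ _ _) => /=.
move=> hw; apply/permP => i; rewrite perm1; apply/val_inj/eqP; rewrite eqn_leq ge // andbT.
have hwV : forall i j : 'I_N, (i < j)%N -> ((w^-1)%g i < (w^-1)%g j)%N.
  move=> a b ab; rewrite ltnNge leq_eqVlt; apply/negP => /orP[/eqP/val_inj/perm_inj e|/hw].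
    by rewrite e ltnn in ab.
  by rewrite !permKV ltnNge (ltnW ab).
by have := ge _ hwV (w i); rewrite permK.
Qed.

(** Both exponent vectors decrease strictly, so a permutation matching them is increasing, hence the
    identity. *)
Lemma mcoeff_alternant_shifted N la mu :
  is_partition la -> is_partition mu -> (size la <= N)%N -> (size mu <= N)%N ->
  (alternant (@shifted N mu))@_[multinom shifted la i | i < N] = (la == mu)%:R.
Proof.
move=> hla hmu sla smu; rewrite alternantE raddf_sum /=.
have hw (w : 'S_N) : [multinom shifted mu (w i) | i < N] =
    [multinom shifted la i | i < N] -> w = 1%g /\ la = mu.
  move=> /mnmP e.
  have {}e i : shifted mu (w i) = shifted la i by have := e i; rewrite !mnmE.
  have w1 : w = 1%g.
    apply: incr_perm1 => i j ij; have := strictly_dec_shifted hla ij.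
    rewrite -!e (ltnNge (w i)); apply: contraTN; rewrite -leqNgt.
    rewrite leq_eqVlt => /predU1P[/val_inj -> //|/(strictly_dec_shifted hmu)].
    exact: ltnW.
  split=> //; apply: eq_partition => // i; case: (ltnP i N) => hi; last first.
    by rewrite !nth_default // (leq_trans _ hi).
  have := e (Ordinal hi); rewrite w1 perm1 /shifted /= => /eqP.
  by rewrite eqn_add2r => /eqP.
under eq_bigr => w _ do rewrite -signr_odd raddfMsign /= mcoeffX.
have [e|ne] := eqVneq la mu; last first.
  by rewrite big1 // => w _; case: eqP => [/hw[_ /eqP]|]; rewrite ?mulr0 // (negbTE ne).
rewrite (bigD1 1%g) //= odd_perm1 mul1r big1 ?addr0.
  by rewrite e; case: eqP => // -[]; apply/mnmP => i; rewrite !mnmE perm1.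
by move=> w /eqP w1; case: eqP => [/hw[]//|]; rewrite mulr0.
Qed.

(** * The Schur expansion of Q_(n-m,m) *)

Lemma mcoeff_staircase_schurQ2 N r s (m : 'X_{1..N}) :
  (alternant (@staircase N) * schurQ2 N r s)@_m =
  if mdeg m == (r + s + \sum_i @staircase N i)%N then
    skew_coef s (\det (\matrix_(i, j)
      if (@staircase N j <= m i)%N then qqcoef (m i - @staircase N j)%N else 0))
  else 0.
Proof. by apply: mcoeff_alternant_mul => k; exact: mcoeff_schurQ2. Qed.

Lemma alternating_staircase_schurQ2 N r s :
  alternating (alternant (@staircase N) * schurQ2 N r s).
Proof.
move=> w; rewrite rmorphM /= alternating_alternant -mulrA; congr (_ * (_ * _)).
apply/mpolyP => m; rewrite mcoeff_sym !mcoeff_schurQ2 mdeg_mperm.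
case: eqP => // _; congr skew_coef; rewrite [RHS](reindex_inj (@perm_inj _ w)) /=.
by apply: eq_bigr => i _; rewrite mnmE.
Qed.

(** As delta_j = N - 1 - j, the difference (la_i + delta_i) - delta_j is la_i - i + j. *)
Lemma jt_shifted N la :
  \det (\matrix_(i < N, j < N)
      if (staircase j <= shifted la i)%N
      then qqcoef (shifted la i - staircase j)%N else 0) =
  jt N qqcoef (nth 0%N la).
Proof.
congr (\det _); apply/matrixP => i j; rewrite !mxE /jt_entry /staircase /shifted.
have hi := ltn_ord i; have hj := ltn_ord j.
have -> : (N - j.+1 <= nth 0 la i + (N - i.+1))%N = (i <= nth 0 la i + j)%N by lia.
by case: ifP => // h; congr qqcoef; lia.
Qed.

Lemma mdeg_shifted N la : (size la <= N)%N ->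
  mdeg [multinom shifted la i | i < N] = (sumn la + \sum_i @staircase N i)%N.
Proof.
move=> h; rewrite mdegE -(sum_nth_sumn h) -big_split.
by apply: eq_bigr => i _; rewrite mnmE.
Qed.

(** The claimed coefficients, extended by 0 as [is_schur_expansion] demands. *)
Definition Qcoef (n m : nat) (la : seq nat) : int :=
  if is_partition_of n la then
   4 * ((Nstrip (n%:Z - m%:Z - (head 0%N la)%:Z) la)%:Z
        - (Nstrip (m%:Z - (head 0%N la)%:Z) la)%:Z)
  else 0.

Lemma mcoeff_shifted_schurQ2 N n m la : (0 < m < n)%N -> is_partition la ->
  (size la <= N)%N ->
  (alternant (@staircase N) * schurQ2 N (n - m) m)@_[multinom shifted la i | i < N]
  = Qcoef n m la.
Proof.
move=> /andP[m0 mn] hla sla; rewrite mcoeff_staircase_schurQ2 mdeg_shifted //.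
rewrite eqn_add2r subnK ?(ltnW mn) // /Qcoef /is_partition_of hla /=.
case: eqP => // hn.
have -> : (\matrix_(i, j) if (@staircase N j <= [multinom shifted la i | i < N] i)%N then
      qqcoef ([multinom shifted la i | i < N] i - @staircase N j)%N else 0) =
   (\matrix_(i, j) if (@staircase N j <= shifted la i)%N then
      qqcoef (shifted la i - staircase j)%N else 0).
  by apply/matrixP => i j; rewrite !mxE mnmE.
rewrite jt_shifted.
case: la hla sla hn => [|a mu] hla sla hn; first by move: mn; rewrite -hn.
case: N sla => // N smu; have hmu : is_partition mu := is_partition_behead hla.
have {}smu : (size mu <= N)%N := smu.
have a0 : (0 < a)%N by have := partition_nth_gt0 0 hla.
have pdec i := partition_dec i hmu.
have pN : nth 0%N mu N = 0%N by rewrite nth_default.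
(* The factor (1 - v)/(1 + v) cancels against those of [jt_qqcoef], leaving the coefficient of v^m
   in a difference of two strip sums. *)
rewrite (skew_coef_ratio _ (@jt_qqcoef N (nth 0%N (a :: mu)) a0)) /=.
rewrite -polyC_natr coefCM coefB coef_strips_X // coef_strips_1 //; last first.
  by rewrite (sum_nth_sumn smu) -[(a + _)%N]/(sumn (a :: mu)) hn.
rewrite !(NstripE hmu smu) // (sum_nth_sumn smu) !sumr_const !cardsE.
have two_mulrn k : 2 *+ k = 2 * k%:Z :> int by rewrite -[2 *+ k]mulr_natr (natz k).
(* The 4 is the outer 2 times the weight 2 of each strip. The conditions |S| + m = n - a and a + |S|
   = m become |S| = n - m - a and |S| = m - a over the integers, so negative values match no S. *)
rewrite !two_mulrn -mulrBr mulrA; congr (_ * (Posz _ - Posz _)); apply: eq_card => S.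
  rewrite !unfold_in; congr [&& _, _ & _].
  rewrite -hn /= -eqz_nat !PoszD; lia.
rewrite !unfold_in; congr [&& _, _ & _]; lia.
Qed.

(** All Schur functions share the denominator a_delta, which is nonzero because its coefficient at
    x^delta is 1. *)
Lemma schur_expansionP N xi (b : seq nat -> int) :
  tofrac (schurQ N xi) = \sum_(la <- partitions (sumn xi)) schur N la *~ b la <->
  alternant (@staircase N) * schurQ N xi =
  \sum_(la <- partitions (sumn xi) | (size la <= N)%N) alternant (@shifted N la) *~ b la.
Proof.
have d0 : tofrac (alternant (@staircase N)) != 0.
  rewrite tofrac_eq0; apply/eqP => e.
  have := @mcoeff_alternant_shifted N [::] [::] isT isT isT isT.
  rewrite (_ : alternant _ = alternant (@staircase N)).
    by rewrite e mcoeff0.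
  by congr (\det _); apply/matrixP => i j; rewrite !mxE /shifted nth_nil.
have -> : \sum_(la <- partitions (sumn xi)) schur N la *~ b la =
   tofrac (\sum_(la <- partitions (sumn xi) | (size la <= N)%N)
             alternant (@shifted N la) *~ b la)
   / tofrac (alternant (@staircase N)).
  rewrite rmorph_sum /= mulr_suml [RHS]big_mkcond /=; apply: eq_bigr => la _.
  rewrite /schur; case: ifP => _; last by rewrite mul0rz.
  by rewrite rmorphMz /= mulrzAl.
split=> [e|<-].
  by apply/eqP; rewrite -tofrac_eq rmorphM /= e mulrC divfK.
by rewrite rmorphM /= mulrAC divff ?mul1r.
Qed.

Lemma alternatingB N (P Q : {mpoly int[N]}) :
  alternating P -> alternating Q -> alternating (P - Q).
Proof. by move=> hP hQ s; rewrite rmorphB /= hP hQ mulrBr. Qed.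

Lemma mcoeff_sum_alternant N n (b : seq nat -> int) la :
  is_partition la -> (size la <= N)%N ->
  (\sum_(mu <- partitions n | (size mu <= N)%N)
      alternant (@shifted N mu) *~ b mu)@_[multinom shifted la i | i < N] =
  if is_partition_of n la then b la else 0.
Proof.
move=> hla sla; rewrite raddf_sum /= -mem_partitions.
transitivity (\sum_(mu <- partitions n | mu == la) b la).
  rewrite big_mkcond [RHS]big_mkcond /=; apply: eq_big_seq => mu.
  rewrite mem_partitions => /andP[hmu _].
  case: ifP => smu; last by case: eqP => // e; rewrite e sla in smu.
  rewrite raddfMz /= mcoeff_alternant_shifted // eq_sym.
  by case: eqP => [->|_]; rewrite ?mul0rz // intz.
rewrite big_const_seq -(eq_count (a1 := pred1 la)) // count_uniq_mem ?partitions_uniq //.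
by case: (_ \in _) => //=; rewrite addr0.
Qed.

(** Strict decrease forces m_i >= N - 1 - i, and subtracting delta leaves a weakly decreasing
    sequence. *)
Lemma strictly_decP N (m : 'X_{1..N}) : strictly_dec (fun i => m i) ->
  exists la, [/\ is_partition la, (size la <= N)%N & m = [multinom shifted la i | i < N]].
Proof.
move=> hm; pose q i := if insub i is Some j then (m j - (N - i.+1))%N else 0%N.
have qE (i : 'I_N) : q i = (m i - (N - i.+1))%N by rewrite /q valK.
have qN i : (N <= i)%N -> q i = 0%N by move=> h; rewrite /q insubN // -leqNgt.
have qNN := qN N (leqnn N).
have mge (i : 'I_N) : (N - i.+1 <= m i)%N.
  case: i => i hi /=; move e: (N - i.+1)%N => k; elim: k i hi e => // k IH i hi e.
  have hi1 : (i.+1 < N)%N by rewrite -subn_gt0 e.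
  apply: leq_ltn_trans (IH _ hi1 _) (hm (Ordinal hi) (Ordinal hi1) _) => //=.
  by rewrite subnS e.
have qdec i : (q i.+1 <= q i)%N.
  case: (ltnP i.+1 N) => hi; last by rewrite qN.
  have := qE (Ordinal hi); have := qE (Ordinal (ltnW hi)) => /= -> ->.
  have /= := hm (Ordinal (ltnW hi)) (Ordinal hi) (leqnn _); lia.
exists (to_partition N q); split.
- by apply: is_partition_to_partition => //; exact: qN.
- exact: size_to_partition.
apply/mnmP => i; rewrite mnmE /shifted nth_to_partition // qE.
by rewrite subnK.
Qed.

(** Both sides are alternating, so comparing the coefficients at the exponents la + delta
    suffices. *)
Lemma schurQ2_expansion N n m : (0 < m < n)%N ->
  alternant (@staircase N) * schurQ N [:: (n - m)%N; m] =
  \sum_(la <- partitions n | (size la <= N)%N)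
     alternant (@shifted N la) *~ Qcoef n m la.
Proof.
move=> hmn; rewrite schurQ_two; apply/eqP; rewrite -subr_eq0; apply/eqP.
apply: alternating_eq0 => [|_ /strictly_decP[la [hla sla ->]]].
  apply: alternatingB => [|s]; first exact: alternating_staircase_schurQ2.
  rewrite rmorph_sum mulr_sumr; apply: eq_bigr => la _ /=.
  by rewrite rmorphMz /= alternating_alternant mulrzAr.
rewrite mcoeffB mcoeff_shifted_schurQ2 // mcoeff_sum_alternant // /Qcoef.
by case: ifP => _; rewrite subrr.
Qed.

Theorem theorem4p5 (n m : nat) (la : seq nat)
    (hm : (1 <= m)%N) (hmn : (2 * m < n)%N) (hla : is_partition_of n la) :
  (bcoef [:: (n - m)%N; m] la =
   4 * ((Nstrip (n%:Z - m%:Z - (head 0%N la)%:Z) la)%:Z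
        - (Nstrip (m%:Z - (head 0%N la)%:Z) la)%:Z))%R.
Proof.
have mn : (0 < m < n)%N by lia.
have sxi : sumn [:: (n - m)%N; m] = n by rewrite /= addn0 subnK; lia.
have [_ expansion] : is_schur_expansion [:: (n - m)%N; m] (bcoef [:: (n - m)%N; m]).
  (* [epsilon] returns an expansion once one exists, and [Qcoef n m] is one. *)
  apply: epsilon_spec; exists (Qcoef n m); rewrite /is_schur_expansion sxi; split.
    by move=> mu /negbTE hmu; rewrite /Qcoef hmu.
  move=> N; have := proj2 (schur_expansionP N [:: (n - m)%N; m] (Qcoef n m)).
  by rewrite sxi; apply; exact: schurQ2_expansion.
have /andP[hp _] := hla.
(* With [size la] variables, the coefficient at x^(la + delta) isolates the value at [la], so any
   two expansions agree there. *)
have := proj1 (schur_expansionP _ _ _) (expansion (size la)); rewrite sxi schurQ2_expansion //.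
move/(congr1 (fun P => P@_[multinom shifted la i | i < size la])).
by rewrite !mcoeff_sum_alternant // /Qcoef hla => <-.
Qed.
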